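(* For all integers $k,h\ge1$ there exists an oracle $\mathcal{A}$ such that $R^{p}_{k\text{-}T}(\mathrm{UP}_{\le h}^{\mathcal{A}})\not\subseteq R^{p,\mathcal{A}}_{(2^k-2)\text{-}tt}(\mathrm{NP}^{\mathrm{U}\Sigma^{p,\mathcal{A}}_{h-1}})$.
   Context: Alphabet $\{0,1\}$. $\mathrm{UP}_{\le h}^{A}$: sets accepted by a nondeterministic polynomial-time oracle Turing machine with oracle $A$ having at most $h$ accepting paths on every input. A $\Sigma_j(A)$-system $[A;N_1,\dots,N_j]$ consists of $A$ and nondeterministic polynomial-time oracle Turing machines; its language is $L[A;N_1]=L(N_1^A)$ and $L[A;N_1,\dots,N_j]=L(N_1^{L[A;N_2,\dots,N_j]})$; its computation on $x$ is that of $N_1$ on $x$ with oracle $A$ ($j=1$) or $L[A;N_2,\dots,N_j]$ ($j>1$); it is unambiguous if for every $1\le i\le j$ and every input $y$, $[A;N_i,\dots,N_j](y)$ has at most one accepting path. $\mathrm{U}\Sigma^{p,A}_0=\mathrm{P}^A$ and $\mathrm{U}\Sigma^{p,A}_j$ ($j\ge1$) is the class of languages of unambiguous $\Sigma_j(A)$-systems. $\mathrm{NP}^{\mathcal{C}}$: sets accepted by nondeterministic polynomial-time oracle machines with an oracle from $\mathcal{C}$. $R^p_{k\text{-}T}(\mathcal{C})$: sets decided by a deterministic polynomial-time oracle machine making at most $k$ adaptive queries to some $D\in\mathcal{C}$. $R^{p,A}_{(2^k-2)\text{-}tt}(\mathcal{C})$: sets decided by a deterministic polynomial-time oracle machine with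 access to $A$ and to some $D\in\mathcal{C}$ that on every input asks at most $2^k-2$ nonadaptive queries to $D$ (all queries to $D$ are fixed before any answer from $D$ is received). *)

(* Defs.v *)
From mathcomp Require Import all_boot all_order all_algebra.
From mathcomp Require Import boolp classical_sets.

Set Implicit Arguments.
Unset Strict Implicit.
Unset Printing Implicit Defensive.

Local Open Scope classical_set_scope.

Notation word := (seq bool).
Notation language := (set word).
Notation langclass := (set language).

(** * Tapes *)

(* [None] is the blank, [Some (inl b)] the bit [b]; the others are auxiliary. *)
Notation symbol g := (option (bool + 'I_g)).

(* [Some true] moves right, [Some false] moves left, [None] does not move. *)
Notation move := (option bool).

(* A two-way infinite tape: the cells to the left of the head (nearest first),
   the scanned cell, the cells to its right; all further cells are blank. *)
Notation tape g := (seq (symbol g) * symbol g * seq (symbol g))%type.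

Definition scanned g (t : tape g) : symbol g := t.1.2.

Definition blank_tape g : tape g := ([::], None, [::]).

Definition tape_of g (x : word) : tape g :=
  if [seq Some (inl b) | b <- x] is s :: r then ([::], s, r) else blank_tape g.

Definition write_move g (s : symbol g) (m : move) (t : tape g) : tape g :=
  let: (l, _, r) := t in
  match m with
  | None => (l, s, r)
  | Some true => (s :: l, head None r, behead r)
  | Some false => (behead l, head None l, s :: r)
  end.

(* The bits on the tape, from left to right, wherever the head is; cells that
   do not hold a bit are skipped. *)
Definition tape_word g (t : tape g) : word :=
  let: (l, s, r) := t in
  pmap (fun a : symbol g => if a is Some (inl b) then Some b else None)
       (rev l ++ s :: r).

(** * Nondeterministic multi-tape Turing machines with oracles indexed by I *)

(* [None] is the input tape, [Some (inl i)] the query tape of oracle [i],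
   [Some (inr j)] the [j]-th work tape. *)
Notation tape_index I w := (option (I + 'I_w)).

(* The initial state is [ord0].  A state [q] with [otm_query q = Some i] is a
   query state: the machine asks oracle [i] about the word on its query tape,
   that tape is erased, and the next state is [otm_answer (q, b)] where [b] is
   the answer.  In the other states [otm_delta] gives, for the scanned symbols,
   the set of possible actions; the machine halts where this set is empty. *)
Record otm (I : finType) := OTM {
  otm_nstates : nat;
  otm_nsyms : nat;
  otm_nwork : nat;
  otm_accept : {set 'I_otm_nstates.+1};
  otm_query : {ffun 'I_otm_nstates.+1 -> option I};
  otm_answer : {ffun 'I_otm_nstates.+1 * bool -> 'I_otm_nstates.+1};
  otm_delta :
    {ffun 'I_otm_nstates.+1 * {ffun tape_index I otm_nwork -> symbol otm_nsyms} ->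
      {set 'I_otm_nstates.+1 *
           {ffun tape_index I otm_nwork -> symbol otm_nsyms * move}}}
}.

Definition state (I : finType) (M : otm I) : finType := 'I_(otm_nstates M).+1.

Definition tapes (I : finType) (M : otm I) : finType := tape_index I (otm_nwork M).

Notation action M :=
  (state M * {ffun tapes M -> symbol (otm_nsyms M) * move})%type.
Notation config M := (state M * {ffun tapes M -> tape (otm_nsyms M)})%type.

Section Computation.
Variables (I : finType) (M : otm I).

Definition initial (x : word) : config M :=
  (ord0, [ffun j => if j is None then tape_of _ x else blank_tape _]).

Definition actions (c : config M) : {set action M} :=
  otm_delta M (c.1, [ffun j => scanned (c.2 j)]).

Definition act (c : config M) (a : action M) : config M :=
  (a.1, [ffun j => write_move (a.2 j).1 (a.2 j).2 (c.2 j)]).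

Definition query_word (c : config M) (i : I) : word :=
  tape_word (c.2 (Some (inl i))).

Definition answered (c : config M) (i : I) (b : bool) : config M :=
  (otm_answer M (c.1, b),
   [ffun j => if j == Some (inl i) then blank_tape _ else c.2 j]).

Definition step (O : I -> language) : rel (config M) := fun c c' =>
  if otm_query M c.1 is Some i then
    c' == answered c i (query_word c i \in O i)
  else [exists a in actions c, c' == act c a].

Definition halted (c : config M) : bool :=
  (otm_query M c.1 == None) && (actions c == finset.set0).

(* The computation path [initial x :: p] is complete.  Distinct choices of
   actions lead to distinct configurations, so that lists of configurations
   count the computation paths correctly. *)
Definition computation (O : I -> language) (x : word) (p : seq (config M)) : bool :=
  path (step O) (initial x) p && halted (last (initial x) p).

Definition accepting (O : I -> language) (x : word) (p : seq (config M)) : bool :=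
  computation O x p && ((last (initial x) p).1 \in otm_accept M).

Definition lang (O : I -> language) : language :=
  [set x | exists p, accepting O x p].

Definition at_most_accepting (h : nat) (O : I -> language) (x : word) : Prop :=
  forall ps : seq (seq (config M)), uniq ps -> all (accepting O x) ps -> size ps <= h.

Definition queries (i : I) (x : word) (p : seq (config M)) : seq word :=
  [seq query_word c i | c <- initial x :: p & otm_query M c.1 == Some i].

Definition deterministic : Prop := forall qr, #|otm_delta M qr| <= 1.

(* The bound holds on all computation paths and whatever the oracles are. *)
Definition polytime : Prop :=
  exists b : {poly nat}, forall (O : I -> language) (x : word) (p : seq (config M)),
    path (step O) (initial x) p -> size p <= horner b (size x).

End Computation.

Arguments initial {I} M x.
Arguments step {I} M O.
Arguments computation {I} M O x p.
Arguments accepting {I} M O x p.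
Arguments queries {I} M i x p.

(** * Complexity classes *)

Definition oracle (A : language) : unit -> language := fun=> A.

Definition oracles (A D : language) : bool -> language :=
  fun i => if i then D else A.

Definition class_P (A : language) : langclass :=
  [set L | exists M : otm unit,
     [/\ deterministic M, polytime M & L = lang M (oracle A)]].

Definition class_UPle (h : nat) (A : language) : langclass :=
  [set L | exists N : otm unit,
     [/\ polytime N, (forall x, at_most_accepting N h (oracle A) x)
       & L = lang N (oracle A)]].

Definition class_NP (C : langclass) : langclass :=
  [set L | exists D, exists N : otm unit,
     [/\ C D, polytime N & L = lang N (oracle D)]].

(* The system [A; N_1, ..., N_j] is given by [A] and [:: N_1; ...; N_j]; for
   the empty list the language is [A], the oracle of the last machine. *)
Fixpoint sys_lang (A : language) (Ns : seq (otm unit)) : language :=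
  if Ns is N :: Ns' then lang N (oracle (sys_lang A Ns')) else A.

Fixpoint sys_polytime (Ns : seq (otm unit)) : Prop :=
  if Ns is N :: Ns' then polytime N /\ sys_polytime Ns' else True.

Fixpoint sys_unambiguous (A : language) (Ns : seq (otm unit)) : Prop :=
  if Ns is N :: Ns' then
    (forall y, at_most_accepting N 1 (oracle (sys_lang A Ns')) y) /\
    sys_unambiguous A Ns'
  else True.

Definition class_USigma (j : nat) (A : language) : langclass :=
  if j is 0 then class_P A else
  [set L | exists Ns : seq (otm unit),
     [/\ size Ns = j, sys_polytime Ns, sys_unambiguous A Ns
       & L = sys_lang A Ns]].

Definition R_T (k : nat) (C : langclass) : langclass :=
  [set L | exists D, exists M : otm unit,
     [/\ C D, deterministic M, polytime M,
         (forall x p, computation M (oracle D) x p ->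
            size (queries M tt x p) <= k)
       & L = lang M (oracle D)]].

(* On input [x] with first oracle [A], the queries to the second oracle do not
   depend on its answers, and there are at most [n] of them. *)
Definition nonadaptive (M : otm bool) (A : language) (n : nat) (x : word) : Prop :=
  exists2 qs : seq word, size qs <= n &
    forall D p, computation M (oracles A D) x p -> queries M true x p = qs.

Definition R_tt (n : nat) (A : language) (C : langclass) : langclass :=
  [set L | exists D, exists M : otm bool,
     [/\ C D, deterministic M, polytime M, (forall x, nonadaptive M A n x)
       & L = lang M (oracles A D)]].

(* Main.v *)
(* The test language runs a binary search with k queries to the UP-type language
   { z | A contains a word of length |z| }: if A has words of the lengths
   n+1, ..., n+j and of no other length in ]n, n+2^k[, the search on an input of
   length n returns j, and the output is the parity of j.

   Consider a competing machine with at most 2^k - 2 nonadaptive queries to a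
   language D in NP^L, where L is given by an unambiguous system of j machines.
   Adding a word a of a fresh length to A preserves the value of an unambiguous
   system at a given y, except for polynomially many a.  For if y enters the
   language through the additions of a1 and of a2, with accepting paths that do
   not notice the other word, then adding both words yields two accepting paths;
   by induction on j this uses unambiguity for at most j + 1 added words, and
   j + 1 <= h words of one length are allowed.  Hence A can be extended by one
   word of each of the lengths n+1, ..., n+2^k-1 in turn, so that no accepted
   D-query is ever lost and the list of D-queries never changes.  As the parity
   flips each time, some D-query becomes newly accepted each time, that is
   2^k - 1 times among at most 2^k - 2 queries.  If unambiguity or
   nonadaptivity fails for one of the oracles considered, a finite part of that
   oracle already refutes the competitor.  All competitors are treated in turn
   by extending A. *)
Require Import Defs.
From mathcomp Require Import all_boot all_order all_algebra.
From mathcomp Require Import boolp classical_sets.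
From mathcomp Require Import zify.

Set Implicit Arguments.
Unset Strict Implicit.
Unset Printing Implicit Defensive.

Local Open Scope classical_set_scope.

(** * Computation paths *)

Lemma leq_exp_base m n d : m <= n -> m ^ d <= n ^ d.
Proof. by case: d => // d h; rewrite leq_exp2r. Qed.

(** The base [n.+2] is at least 2 for every [n], so the sum of the coefficients can be absorbed into
    the exponent. *)
Lemma horner_le_exp (b : {poly nat}) :
  exists c, forall n, horner b n <= n.+2 ^ c.
Proof.
exists (\sum_(i < size b) (b`_i)%R + size b) => n.
have pos m : 0 < n.+2 ^ m by rewrite expn_gt0.
rewrite horner_coef (@leq_trans ((\sum_(i < size b) (b`_i)%R) * n.+2 ^ size b)) //.
  rewrite big_distrl /=; apply: leq_sum => i _.
  rewrite leq_mul2l; apply/orP; right.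
  rewrite -[(n ^+ i)%R]/(n ^ i) (@leq_trans (n.+2 ^ i)) ?leq_exp2l ?(ltnW (ltn_ord i)) //.
  by apply: leq_exp_base; lia.
rewrite expnD leq_mul2r; apply/orP; right.
by apply: ltnW; apply: ltn_expl.
Qed.

Definition polytime_exp (I : finType) (M : otm I) (d : nat) :=
  forall O x p, path (step M O) (initial M x) p -> size p <= (size x).+2 ^ d.

Lemma polytimeP (I : finType) (M : otm I) :
  polytime M -> exists d, polytime_exp M d.
Proof.
move=> [b hb]; have [d hd] := horner_le_exp b.
by exists d => O x p /hb hp; apply: leq_trans hp (hd _).
Qed.

Section Paths.
Variables (I : finType) (M : otm I).
Implicit Types (O : I -> language) (c : config M).

Definition queries_from i c (p : seq (config M)) : seq word :=
  [seq query_word c i | c <- c :: p & otm_query M c.1 == Some i].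

Lemma eq_path_queries O O' c p :
  (forall i, {in queries_from i c p, forall w, (w \in O i) = (w \in O' i)}) ->
  path (step M O) c p = path (step M O') c p.
Proof.
elim: p c => //= c' p IH c hq; congr (_ && _); last first.
  apply: IH => i w hw; apply: hq; move: hw.
  by rewrite /queries_from /=; case: (otm_query M c.1 == Some i) => //= hw; rewrite inE hw orbT.
rewrite /step; case E: (otm_query M c.1) => [i|] //.
by rewrite hq // /queries_from /= E eqxx /= inE eqxx.
Qed.

Lemma eq_computation_queries O O' x p :
  (forall i, {in queries M i x p, forall w, (w \in O i) = (w \in O' i)}) ->
  computation M O x p = computation M O' x p.
Proof. by move=> h; rewrite /computation (eq_path_queries h). Qed.

Lemma eq_accepting_queries O O' x p :
  (forall i, {in queries M i x p, forall w, (w \in O i) = (w \in O' i)}) ->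
  accepting M O x p = accepting M O' x p.
Proof. by move=> h; rewrite /accepting (eq_computation_queries h). Qed.

Definition cells g (t : tape g) : nat := size t.1.1 + size t.2.

Lemma size_tape_word g (t : tape g) : size (tape_word t) <= (cells t).+1.
Proof.
case: t => [[l s] r]; rewrite /tape_word /cells /= size_pmap.
by apply: leq_trans (count_size _ _) _; rewrite size_cat size_rev /= addnS.
Qed.

Lemma cells_write_move g s m (t : tape g) :
  cells (write_move s m t) <= (cells t).+1.
Proof.
case: t => [[l s'] r]; rewrite /write_move /cells.
by case: m => [[]|] /=; rewrite ?size_behead; lia.
Qed.

Lemma cells_step O c c' j :
  step M O c c' -> cells (c'.2 j) <= (cells (c.2 j)).+1.
Proof.
rewrite /step; case: (otm_query M c.1) => [i /eqP->|/existsP[a /andP[_ /eqP->]]].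
  by rewrite /answered /= ffunE; case: ifP.
by rewrite /act /= ffunE cells_write_move.
Qed.

Lemma cells_path O c p c' j :
  path (step M O) c p -> c' \in c :: p ->
  cells (c'.2 j) <= cells (c.2 j) + size p.
Proof.
elim: p c => [|c1 p IH] c /=; first by move=> _; rewrite inE => /eqP->; rewrite addn0.
move=> /andP[hs hp]; rewrite inE => /orP[/eqP->|/(IH _ hp) h]; first exact: leq_addr.
by rewrite addnS -addSn (leq_trans h) // leq_add2r (cells_step j hs).
Qed.

(** A tape grows by at most one cell per step and the query tape starts blank; the extra 1 is the
    scanned cell. *)
Lemma size_query O x p i w :
  path (step M O) (initial M x) p -> w \in queries M i x p -> size w <= (size p).+1.
Proof.
move=> hp /mapP[c]; rewrite mem_filter => /andP[_ hc] ->.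
apply: leq_trans (size_tape_word _) _.
by have := cells_path (Some (inl i)) hp hc; rewrite /initial /= ffunE.
Qed.

Lemma size_queries x (p : seq (config M)) i : size (queries M i x p) <= (size p).+1.
Proof. by rewrite size_map size_filter; apply: count_size. Qed.

(** A halted configuration has no successor and any other has at most one, so a path can neither
    leave the complete computation nor outrun it. *)
Lemma computation_det O x p p' :
  deterministic M -> path (step M O) (initial M x) p ->
  computation M O x p' -> exists q, p' = p ++ q.
Proof.
move=> hM; rewrite /computation; move: (initial M x) => c.
elim: p c p' => [|c1 p IH] c p'; first by exists p'.
move=> /= /andP[h1 h2]; case: p' => [|c2 p'] /=.
  rewrite /halted; move: h1; rewrite /step => h1 /andP[/eqP hq /eqP ha]; exfalso; move: h1.
  by rewrite hq ha => /existsP[a]; rewrite inE.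
move=> /andP[/andP[h3 h4] h5].
suff e : c2 = c1.
  by move: h4 h5; rewrite e => h4 h5; case: (IH c1 p') => // [|q ->]; [rewrite h4|exists q].
move: h1 h3; rewrite /step; case: (otm_query M c.1) => [i /eqP-> /eqP->//|].
move=> /existsP[a /andP[ha /eqP->]] /existsP[b /andP[hb /eqP->]].
by have /card_le1_eqP h := hM (c.1, [ffun j => scanned (c.2 j)]); rewrite (h _ _ ha hb).
Qed.

Lemma computation_unique O x p p' :
  deterministic M -> computation M O x p -> computation M O x p' -> p = p'.
Proof.
move=> hM hp hp'; have /andP[h1 _] := hp; have /andP[h2 _] := hp'.
have [q e] := computation_det hM h1 hp'; have [q' e'] := computation_det hM h2 hp.
by move: e'; rewrite {1}e -catA -{1}[p]cats0 => /eqP; rewrite eqseq_cat // eqxx /=; case: q e => // ->; rewrite cats0.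
Qed.

(** Otherwise every path could be prolonged, which would give paths longer than the time bound. *)
Lemma computation_exists O x d : polytime_exp M d -> exists p, computation M O x p.
Proof.
move=> hd; apply: contrapT => hno.
suff /(_ (((size x).+2 ^ d).+1)) [p hp hs] : forall n, exists2 p, path (step M O) (initial M x) p & size p = n.
  by have := hd _ _ _ hp; rewrite hs ltnn.
elim=> [|n [p hp hs]]; first by exists [::].
have : ~~ halted (last (initial M x) p).
  by apply/negP => hh; apply: hno; exists p; rewrite /computation hp.
rewrite /halted negb_and; case E: (otm_query M (last (initial M x) p).1) => [i|] /=.
  move=> _; set c := last _ _ in E.
  exists (rcons p (answered c i (query_word c i \in O i))); last by rewrite size_rcons hs.
  by rewrite rcons_path hp /= /step E.
move=> /set0Pn[a ha]; exists (rcons p (act (last (initial M x) p) a)); last by rewrite size_rcons hs.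
by rewrite rcons_path hp /= /step E; apply/existsP; exists a; rewrite ha /=.
Qed.

Lemma deterministic_unambiguous O x : deterministic M -> at_most_accepting M 1 O x.
Proof.
move=> hM [|p [|p' ps]] //= /andP[hu _] /and3P[/andP[h1 _] /andP[h2 _] _].
by move: hu; rewrite inE (computation_unique hM h1 h2) eqxx.
Qed.

End Paths.

(** * Dependence on a finite part of the oracle *)

Definition agree (m : nat) (A A' : language) :=
  forall w, size w <= m -> (w \in A) = (w \in A').

Lemma agreeS m A A' : agree m A A' -> agree m A' A.
Proof. by move=> h w hw; rewrite h. Qed.

Lemma agree_trans m A1 A2 A3 : agree m A1 A2 -> agree m A2 A3 -> agree m A1 A3.
Proof. by move=> h1 h2 w hw; rewrite h1 ?h2. Qed.

Lemma agreeW m m' A A' : m <= m' -> agree m' A A' -> agree m A A'.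
Proof. by move=> h h' w hw; apply: h'; apply: leq_trans hw h. Qed.

Section Locality.
Variables (I : finType) (M : otm I) (d : nat).
Hypothesis hd : polytime_exp M d.

Lemma path_local n (O O' : I -> language) x p :
  (forall i, agree (n.+2 ^ d).+1 (O i) (O' i)) -> size x <= n ->
  path (step M O) (initial M x) p = path (step M O') (initial M x) p.
Proof.
move=> hO hx.
suff H O1 O2 : (forall i, agree (n.+2 ^ d).+1 (O1 i) (O2 i)) ->
    path (step M O1) (initial M x) p -> path (step M O2) (initial M x) p.
  by apply/idP/idP; apply: H => // i; apply: agreeS.
move=> h hp; rewrite -(@eq_path_queries _ _ O1) // => i w hw; apply: h.
apply: leq_trans (size_query hp hw) _; rewrite ltnS.
by apply: leq_trans (hd hp) _; apply: leq_exp_base.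
Qed.
End Locality.

(** * Stability of unambiguous systems *)

Lemma mem_langP (I : finType) (M : otm I) (O : I -> language) x :
  x \in lang M O <-> exists p, accepting M O x p.
Proof. by rewrite in_setE. Qed.

Lemma eq_mem_lang (I J : finType) (M : otm I) (N : otm J) O O' x :
  (x \in lang M O -> x \in lang N O') -> (x \in lang N O' -> x \in lang M O) ->
  (x \in lang M O) = (x \in lang N O').
Proof. by move=> h1 h2; apply/idP/idP. Qed.

Lemma accepting_local (I : finType) (M : otm I) d n (O O' : I -> language) x p :
  polytime_exp M d -> (forall i, agree (n.+2 ^ d).+1 (O i) (O' i)) -> size x <= n ->
  accepting M O x p = accepting M O' x p.
Proof.
by move=> hd hO hx; rewrite /accepting /computation (path_local hd _ hO hx).
Qed.

Lemma lang_local (I : finType) (M : otm I) d n (O O' : I -> language) :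
  polytime_exp M d -> (forall i, agree (n.+2 ^ d).+1 (O i) (O' i)) ->
  agree n (lang M O) (lang M O').
Proof.
move=> hd hO x hx; apply: eq_mem_lang => /mem_langP[p hp]; apply/mem_langP; exists p.
  by rewrite -(accepting_local _ hd hO hx).
by rewrite (accepting_local _ hd hO hx).
Qed.

(** The bounds on query lengths are composed along the system, so [m] depends on [n] and [Ns] but
    not on the oracles. *)
Lemma sys_lang_local Ns : sys_polytime Ns -> forall n, exists m, forall A A',
  agree m A A' -> agree n (sys_lang A Ns) (sys_lang A' Ns).
Proof.
elim: Ns => [|N Ns IH] /= => [_ n|[/polytimeP[d hd] /IH h] n]; first by exists n.
have [m hm] := h (n.+2 ^ d).+1.
by exists m => A A' /hm hA; apply: (lang_local hd).
Qed.

(** Ambiguity is witnessed by one level and one input [y], and acceptance on [y] depends only on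
    oracle words of bounded length. *)
Lemma sys_unambiguous_local A Ns : sys_polytime Ns -> ~ sys_unambiguous A Ns ->
  exists m, forall A', agree m A A' -> ~ sys_unambiguous A' Ns.
Proof.
elim: Ns => [|N Ns IH] //= [/polytimeP[d hd] hNs] hA.
have [hA'|hA'] := pselect (sys_unambiguous A Ns); last first.
  by have [m hm] := IH hNs hA'; exists m => A' /hm h [].
have [y hy] : exists y, ~ at_most_accepting N 1 (oracle (sys_lang A Ns)) y.
  by apply: contrapT => h; apply: hA; split=> // y; apply: contrapT => hy; apply: h; exists y.
have [m hm] := sys_lang_local hNs ((size y).+2 ^ d).+1.
exists m => A' /hm h [h1 _]; apply: hy => ps hu hps; apply: (h1 y) => //.
rewrite -(@eq_all _ (accepting N (oracle (sys_lang A Ns)) y)) // => p.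
by apply: (accepting_local _ hd (n := size y)).  
Qed.

Definition adjoin (A : language) (T : seq word) : language :=
  [set w | A w \/ w \in T].

Lemma mem_adjoin A T w : (w \in adjoin A T) = (w \in A) || (w \in T).
Proof.
apply/idP/idP; first by rewrite in_setE => -[h|->]; rewrite ?orbT //; apply/orP; left; rewrite in_setE.
by move=> /orP[h|h]; rewrite in_setE; [left; rewrite -in_setE|right].
Qed.

Lemma language_ext (A A' : language) : (forall w, (w \in A) = (w \in A')) -> A = A'.
Proof. by move=> h; apply/seteqP; split=> w /mem_set hw; apply: set_mem; rewrite ?h // -h. Qed.

Lemma adjoin_cat A T T' : adjoin (adjoin A T) T' = adjoin A (T ++ T').
Proof. by apply: language_ext => w; rewrite !mem_adjoin mem_cat orbA. Qed.

(** [B] is the pool of candidate words. The exceptional words may depend on [y], but their number is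
    bounded in terms of the length of [y] alone. *)
Definition stable c (B : set word) (A : language) Ns :=
  forall y, exists2 bad : seq word, size bad <= (size y).+2 ^ c &
    forall a, B a -> a \notin bad ->
      (y \in sys_lang (adjoin A [:: a]) Ns) = (y \in sys_lang A Ns).

Lemma exp_slack n e : (n.+2 ^ e + n.+2 ^ e).+2 <= n.+2 ^ e.+2.
Proof.
have : 0 < n.+2 ^ e by rewrite expn_gt0.
by rewrite !expnS; generalize (n.+2 ^ e) => u hu; nia.
Qed.

Lemma stable_seq c B A Ns (ws : seq word) K :
  stable c B A Ns -> all (fun w => size w <= K) ws ->
  exists2 bad : seq word, size bad <= size ws * K.+2 ^ c &
    forall a, B a -> a \notin bad ->
      {in ws, forall w, (w \in sys_lang (adjoin A [:: a]) Ns) = (w \in sys_lang A Ns)}.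
Proof.
move=> hst; elim: ws => [|w ws IH] /=; first by exists [::].
move=> /andP[hw /IH[bad hs hb]]; have [bad' hs' hb'] := hst w.
exists (bad' ++ bad).
  by rewrite size_cat mulSn leq_add // (leq_trans hs') // leq_exp_base.
move=> a hB; rewrite mem_cat negb_or => /andP[h1 h2] u; rewrite inE => /orP[/eqP->|].
  exact: hb'.
exact: hb.
Qed.

(** The path asks at most [(size y).+2 ^ d + 1] queries, each of at most that length; the
    exceptional words of all of them are collected. *)
Lemma stable_queries d c B A Ns N O y p :
  polytime_exp N d -> path (step N O) (initial N y) p -> stable c B A Ns ->
  exists2 bad : seq word, size bad <= (size y).+2 ^ (d.+2 * c.+1) &
    forall a, B a -> a \notin bad -> {in queries N tt y p, forall w,
      (w \in sys_lang (adjoin A [:: a]) Ns) = (w \in sys_lang A Ns)}.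
Proof.
move=> hd hp hst; have hs := hd _ _ _ hp.
have [|bad hbad hb] := @stable_seq _ _ _ _ (queries N tt y p) (size p).+1 hst.
  by apply/allP => w; apply: size_query hp.
exists bad => //; apply: leq_trans hbad _.
have hle : (size y).+2 ^ d + 3 <= (size y).+2 ^ d.+2.
  by apply: leq_trans (exp_slack _ _); rewrite -[X in _ <= X]addn2 -addnA leq_add2l addn2 !ltnS expn_gt0.
rewrite expnM [X in _ <= X]expnS; apply: leq_mul.
  by apply: leq_trans (size_queries _ _ _) _; apply: leq_trans hle; rewrite addnS ltnS (leq_trans hs) ?leq_addr.
by apply: leq_exp_base; apply: leq_trans hle; rewrite -addn3 leq_add2r.
Qed.

(** Pick [b.+1] distinct members [Y] of [X]. A member of [X] outside all their lists would have all
    of [Y] in its own list, which is too short. So [Y] and its lists cover [X], with at most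
    [b.+1 + b.+1 * b] entries. *)
Lemma pairwise_related_bounded (T : eqType) (X : T -> Prop) (bad : T -> seq T) b :
  (forall a, X a -> size (bad a) <= b) ->
  (forall a1 a2, X a1 -> X a2 -> (a1 \in bad a2) || (a2 \in bad a1)) ->
  exists2 l : seq T, size l <= b.+1 * b.+1 & forall a, X a -> a \in l.
Proof.
move=> hb hX.
(* Greedy choice: either [n] distinct members are found, or at most [n] elements exhaust [X]. *)
have alt n : (exists Y : seq T, [/\ uniq Y, size Y = n & forall y, y \in Y -> X y]) \/
    (exists2 l : seq T, size l <= n & forall a, X a -> a \in l).
  elim: n => [|n [[Y [hu hs hY]]|[l hl h]]]; first by left; exists [::].
    have [[a ha hYa]|h] := pselect (exists2 a, X a & a \notin Y).
      left; exists (a :: Y); split; rewrite /= ?hYa ?hs // => y.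
      by rewrite inE => /orP[/eqP->|/hY].
    right; exists Y; rewrite ?hs // => a ha; apply: contrapT => /negP hYa.
    by apply: h; exists a.
  by right; exists l => //; apply: leq_trans hl _.
have [[Y [hu hs hY]]|[l hl h]] := alt b.+1; last first.
  by exists l => //; apply: leq_trans hl _; rewrite leq_pmulr.
exists (Y ++ flatten [seq bad y | y <- Y]).
  rewrite size_cat size_flatten /shape -map_comp hs mulnS leq_add2l -hs.
  elim: Y hY {hu hs} => //= y Y IH hY; rewrite mulSn leq_add //.
    by apply: hb; apply: hY; rewrite inE eqxx.
  by apply: IH => z hz; apply: hY; rewrite inE hz orbT.
move=> a ha; apply: contrapT => /negP; rewrite mem_cat negb_or => /andP[_ hn].
suff : size Y <= size (bad a) by rewrite hs => h; have := leq_trans h (hb _ ha); rewrite ltnn.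
apply: uniq_leq_size => // y hy; have /orP[h|//] := hX a y ha (hY y hy).
by case/negP: hn; apply/flattenP; exists (bad y) => //; apply: map_f.
Qed.

(** Preservation in one direction only: an accepting path survives as long as the answers to its own
    queries do not change. *)
Lemma accepting_stable d c B A Ns N y :
  polytime_exp N d -> stable c B A Ns -> y \in lang N (oracle (sys_lang A Ns)) ->
  exists2 bad : seq word, size bad <= (size y).+2 ^ (d.+2 * c.+1) &
    forall a, B a -> a \notin bad -> y \in lang N (oracle (sys_lang (adjoin A [:: a]) Ns)).
Proof.
move=> hd hst /mem_langP[p hp]; have /andP[/andP[hpath _] _] := hp.
have [bad hs hb] := stable_queries hd hpath hst.
exists bad => // a hB ha; apply/mem_langP; exists p.
by rewrite -(@eq_accepting_queries _ _ (oracle (sys_lang A Ns))) // => -[] w hw; rewrite /oracle hb.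
Qed.

(** Induction on the system. Each level uses up one added word, since the tail has to be stable both
    over [A] and over [A] with one word adjoined; this explains the bound [(size Ns).+1]. *)
Lemma sys_stable Ns : sys_polytime Ns -> exists c, forall (B : set word) A,
  (forall T : seq word, size T <= (size Ns).+1 -> (forall a, a \in T -> B a) ->
     sys_unambiguous (adjoin A T) Ns) ->
  stable c B A Ns.
Proof.
elim: Ns => [|N Ns IH] /=.
  (* The language of the empty system is the oracle itself, so only [y] is exceptional. *)
  move=> _; exists 0 => B A _ y; exists [:: y] => //= a _.
  by rewrite inE mem_adjoin inE eq_sym => /negbTE->; rewrite orbF.
move=> [/polytimeP[d hd] /IH[c hc]]; pose e := d.+2 * c.+1.
(* The factor 2 is the square in [pairwise_related_bounded]; its lists have up to
   [2 * (size y).+2 ^ e] entries, and [e.+2] absorbs the doubling and the successor. *)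
exists (e.+2 * 2) => B A hA y.
have un T : size T <= (size Ns).+2 -> (forall a, a \in T -> B a) -> sys_unambiguous (adjoin A T) Ns.
  by move=> h1 h2; case: (hA T h1 h2).
have st0 : stable c B A Ns by apply: hc => T hT; apply: un; apply: leqW.
have st1 a : B a -> stable c B (adjoin A [:: a]) Ns.
  move=> ha; apply: hc => T hT hB; rewrite adjoin_cat; apply: un => // b.
  by rewrite inE => /orP[/eqP->|/hB].
have le_e := exp_slack (size y) e.
have [yA|yA] := boolP (y \in lang N (oracle (sys_lang A Ns))).
  have [bad hs hb] := accepting_stable hd st0 yA.
  exists bad; first by apply: leq_trans hs _; rewrite leq_exp2l // /e; lia.
  by move=> a ha /(hb a ha)->.
pose O a := oracle (sys_lang (adjoin A [:: a]) Ns).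
(* These are the words whose addition brings [y] into the language; they have to be few. *)
pose X a := B a /\ y \in lang N (O a).
(* To each such [a] belong an accepting path and a list; a candidate [a'] outside the list changes
   no answer on that path, neither over [A] nor over [A] with [a]. *)
have /choice[f hf] : forall a, exists pb : seq (config N) * seq word, X a ->
  [/\ accepting N (O a) y pb.1, size pb.2 <= (size y).+2 ^ e + (size y).+2 ^ e &
    forall a', B a' -> a' \notin pb.2 -> {in queries N tt y pb.1, forall w,
      (w \in sys_lang (adjoin A [:: a']) Ns) = (w \in sys_lang A Ns) /\
      (w \in sys_lang (adjoin A [:: a; a']) Ns) = (w \in sys_lang (adjoin A [:: a]) Ns)}].
  move=> a; have [[ha /mem_langP[p hp]]|h] := pselect (X a); last by exists ([::], [::]).
  have /andP[/andP[hpath _] _] := hp.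
  have [b0 hs0 hb0] := stable_queries hd hpath st0.
  have [b1 hs1 hb1] := stable_queries hd hpath (st1 a ha).
  exists (p, b0 ++ b1) => _; split=> //=; first by rewrite size_cat leq_add.
  move=> a' ha'; rewrite mem_cat negb_or => /andP[h0 h1] w hw; rewrite hb0 //; split=> //.
  by rewrite -(hb1 a' _ _ w) // adjoin_cat.
have [||l hl hX] := @pairwise_related_bounded _ X (fun a => (f a).2) ((size y).+2 ^ e + (size y).+2 ^ e).
- by move=> a /hf[].
- move=> a1 a2 h1 h2; rewrite -[_ || _]negbK negb_or; apply/negP => /andP[n1 n2].
  have [p1 _ b1] := hf _ h1; have [p2 _ b2] := hf _ h2.
  have B1 := proj1 h1; have B2 := proj1 h2.
  have swap : adjoin A [:: a2; a1] = adjoin A [:: a1; a2].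
    by apply: language_ext => w; rewrite !mem_adjoin !inE [(w == a2) || _]orbC.
  have ac1 : accepting N (oracle (sys_lang (adjoin A [:: a1; a2]) Ns)) y (f a1).1.
    by rewrite -(eq_accepting_queries (O := O a1)) // => -[] w hw; rewrite /oracle (b1 a2 B2 n2 w hw).2.
  have ac2 : accepting N (oracle (sys_lang (adjoin A [:: a1; a2]) Ns)) y (f a2).1.
    by rewrite -swap -(eq_accepting_queries (O := O a2)) // => -[] w hw; rewrite /oracle (b2 a1 B1 n1 w hw).2.
  have [|hun _] := hA [:: a1; a2] isT.
    by move=> b; rewrite !inE => /orP[]/eqP->.
  (* Both paths accept when both words are present, so unambiguity makes them equal. On the common
     path, adding [a2] to [A] changes no answer, so it accepts already over [A], against [yA]. *)
  have e12 : (f a1).1 = (f a2).1.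
    apply: contrapT => /eqP ne; have := hun y [:: (f a1).1; (f a2).1].
    by rewrite /= inE ne ac1 ac2 => /(_ isT isT).
  case/negP: yA; apply/mem_langP; exists (f a2).1.
  by rewrite -(eq_accepting_queries (O := O a2)) // -e12 => -[] w hw; rewrite /O /oracle (b1 a2 B2 n2 w hw).1.
exists l.
  apply: leq_trans hl _; rewrite expnM expnS expn1.
  by apply: leq_mul; apply: ltnW.
move=> a ha hl'; transitivity false; last by apply: esym; apply: negbTE.
apply/negbTE/negP => h.
by case/negP: hl'; apply: hX.
Qed.

(** * The chain of extensions *)

Lemma mem_lang_computation (I : finType) (M : otm I) O x p :
  deterministic M -> computation M O x p ->
  (x \in lang M O) = ((last (initial M x) p).1 \in otm_accept M).
Proof.
move=> hM hp; apply/idP/idP => [/mem_langP[p' /andP[hp' ha]]|h].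
  by rewrite (computation_unique hM hp hp').
by apply/mem_langP; exists p; rewrite /accepting hp.
Qed.

Lemma exists_fresh_word n (s : seq word) :
  size s < 2 ^ n -> exists2 a, size a = n & a \notin s.
Proof.
move=> hs; apply: contrapT => hno.
have : size [seq val t | t <- enum {: n.-tuple bool}] <= size s.
  apply: uniq_leq_size; first by rewrite map_inj_uniq ?enum_uniq //; apply: val_inj.
  move=> a /mapP[t _ ->]; apply: contrapT => /negP h.
  by apply: hno; exists (val t) => //; apply: size_tuple.
by rewrite size_map -cardE card_tuple card_bool leqNgt hs.
Qed.

Lemma exp_lt_exp2 E m : exists2 n, m <= n & n.+2 ^ E < 2 ^ n.
Proof.
(* With this [n], [n.+2 ^ E] is at most [2 ^ (t.+1 * E)], and [t.+1 * E <= 2 * s.+1 * s < 2 ^ t]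
   because [2 ^ t] is twice the square of [2 ^ s] and [s < 2 ^ s]. *)
pose s := E + m; pose t := (s + s).+1; exists (2 ^ t).
  by apply: leq_trans (ltnW (ltn_expl t (ltnSn 1))); rewrite /t /s; lia.
apply: (@leq_ltn_trans ((2 ^ t.+1) ^ E)).
  apply: leq_exp_base; rewrite [2 ^ t.+1]expnS mul2n -addnn -addn2 leq_add2l.
  by rewrite -[X in X <= _](expn1 2) leq_exp2l.
rewrite -expnM ltn_exp2l // {2}/t expnS expnD.
have := ltn_expl s (ltnSn 1); have : E <= s by apply: leq_addr.
by rewrite /t; generalize (2 ^ s) s => u v; nia.
Qed.

Lemma count_lt (T : eqType) (P Q : pred T) (s : seq T) :
  {in s, forall w, P w -> Q w} -> ~ {in s, P =1 Q} -> count P s < count Q s.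
Proof.
elim: s => [|w s IH] hPQ hne; first by case: hne.
have hs : {in s, forall w, P w -> Q w} by move=> v hv; apply: hPQ; rewrite inE hv orbT.
have hw : P w -> Q w by apply: hPQ; rewrite inE eqxx.
have [eqs|nes] := pselect {in s, P =1 Q}.
  rewrite /= -(eq_in_count eqs) ltn_add2r.
  have neq : P w != Q w.
    by apply/eqP => e; apply: hne => v; rewrite inE => /orP[/eqP->|/eqs].
  by case: (P w) (Q w) neq hw => [] [] // _ /(_ isT).
rewrite /= -addnS leq_add //; last exact: IH.
by case: (P w) hw => //= ->.
Qed.

(** Stated with duplicate-free lists to match [at_most_accepting]: it bounds the accepting paths of
    the machine that guesses a word of [A]. *)
Definition slender h (A : language) := forall n (us : seq word),
  uniq us -> all (fun u => (u \in A) && (size u == n)) us -> size us <= h.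

Definition occupied (A : language) n := exists2 u, size u = n & u \in A.

(** The condition concerns one length at a time, so it passes to limits. *)
Lemma slender_agree h A : (forall m, exists2 A', slender h A' & agree m A A') -> slender h A.
Proof.
move=> hA n us hu hus; have [A' hA' e] := hA n; apply: (hA' n) => //.
by apply: sub_all hus => u /andP[h1 /eqP h2]; rewrite -e ?h1 h2 ?leqnn ?eqxx.
Qed.

Lemma slender_adjoin h (A : language) n (T : seq word) : slender h A -> (forall u : word, u \in A -> size u <> n) ->
  size T <= h -> (forall u : word, u \in T -> size u = n) -> slender h (adjoin A T).
Proof.
move=> hA hn hT hs m us hu /allP hus; have [e|/eqP ne] := eqVneq m n.
  apply: leq_trans hT; apply: uniq_leq_size => // u /hus /andP[+ /eqP su].
  by rewrite mem_adjoin => /orP[/hn|//]; rewrite su.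
apply: (hA m) => //; apply/allP => u /hus; rewrite mem_adjoin => /andP[/orP[->//|/hs e] /eqP e'].
by case: ne; rewrite -e'.
Qed.

Section Chain.
Variables (h k q c dM dN : nat) (M : otm bool) (N : otm unit) (Ns : seq (otm unit)).
Hypotheses (hh : 0 < h) (hM : deterministic M) (hdM : polytime_exp M dM) (hdN : polytime_exp N dN).
Variables (A0 : language) (n : nat) (x : word).
Hypothesis hst : forall (B : set word) A,
  (forall T : seq word, size T <= (size Ns).+1 -> (forall a, a \in T -> B a) ->
     sys_unambiguous (adjoin A T) Ns) -> stable c B A Ns.
Hypothesis hun : forall A m (T : seq word), agree n A0 A -> slender h A -> n < m ->
  (forall u : word, u \in A -> size u <> m) -> size T <= (size Ns).+1 ->
  (forall u : word, u \in T -> size u = m) -> sys_unambiguous (adjoin A T) Ns.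
Hypothesis hna : forall A, agree n A0 A -> slender h A -> nonadaptive M A q x.
Let K := ((size x).+2 ^ dM).+1.
(** This leaves a free word: [M] puts at most [K] queries to its first oracle, and each of the at
    most [q] other queries excludes at most [K.+2 ^ (dN.+2 * c.+1)] words. *)
Hypothesis hn : K + q * K.+2 ^ (dN.+2 * c.+1) < 2 ^ n.

Definition filled A j := [/\ agree n A0 A, slender h A &
  forall m, 0 < m -> occupied A (n + m) <-> m <= j].

Hypothesis hdec : forall A j, filled A j -> j < 2 ^ k ->
  (x \in lang M (oracles A (sys_lang A (N :: Ns)))) = odd j.

Lemma chain_step A j (qs : seq word) : filled A j -> j.+1 < 2 ^ k -> size qs <= q ->
  (forall D p, computation M (oracles A D) x p -> queries M true x p = qs) ->
  exists2 A', filled A' j.+1 &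
    (forall D p, computation M (oracles A' D) x p -> queries M true x p = qs) /\
    count (mem (sys_lang A (N :: Ns))) qs < count (mem (sys_lang A' (N :: Ns))) qs.
Proof.
move=> hA hj hqs hq; have [agA slA occA] := hA.
pose B : set word := [set a | size a = n + j.+1].
have free u : u \in A -> size u <> n + j.+1.
  by move=> uA su; have := (occA j.+1 isT).1 (ex_intro2 _ _ u su uA); rewrite ltnn.
have st : stable c B A Ns.
  apply: hst => T hT hTB; apply: (hun agA slA (m := n + j.+1)) => //.
  by rewrite -addSnnS leq_addr.
pose D := sys_lang A (N :: Ns).
have [p hp] := computation_exists (oracles A D) x hdM.
have /andP[hpath hhalt] := hp.
have hsz := hdM hpath.
have eqs : queries M true x p = qs := hq _ _ hp.
have qsK : all (fun w => size w <= K) qs.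
  by apply/allP => w; rewrite -eqs => /(size_query hpath) hw; apply: leq_trans hw _.
have [bad hbad hb] : exists2 bad : seq word, size bad <= size qs * K.+2 ^ (dN.+2 * c.+1) &
    forall a, B a -> a \notin bad ->
      {in qs, forall w, w \in D -> w \in sys_lang (adjoin A [:: a]) (N :: Ns)}.
  elim: (qs) qsK => [|w ws IH] /=; first by exists [::].
  move=> /andP[hw /IH[bad hs hb]].
  have [bad' hs' hb'] : exists2 bad' : seq word, size bad' <= K.+2 ^ (dN.+2 * c.+1) &
      forall a, B a -> a \notin bad' -> w \in D -> w \in sys_lang (adjoin A [:: a]) (N :: Ns).
    have [wD|] := boolP (w \in D); last by exists [::].
    have [bad' hs' hb'] := accepting_stable hdN st wD.
    exists bad'; first by apply: leq_trans hs' _; apply: leq_exp_base.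
    by move=> a hB ha _; apply: hb'.
  exists (bad' ++ bad); first by rewrite size_cat mulSn leq_add.
  move=> a hB; rewrite mem_cat negb_or => /andP[h1 h2] u; rewrite in_cons => /orP[/eqP->|].
    exact: (hb' a hB h1).
  exact: (hb a hB h2 u).
(* The new word avoids the queries of [M] to [A] and every word that might cost an accepted query to
   [D]. *)
have [|a sa na] := @exists_fresh_word (n + j.+1) (queries M false x p ++ bad).
  apply: (@leq_trans (2 ^ n)); last by rewrite leq_exp2l // leq_addr.
  apply: leq_ltn_trans hn; rewrite size_cat; apply: leq_add.
    by apply: leq_trans (size_queries _ _ _) _.
  by apply: leq_trans hbad _; rewrite leq_mul2r hqs orbT.
move: na; rewrite mem_cat negb_or => /andP[naM nab].
pose A' := adjoin A [:: a]; pose D' := sys_lang A' (N :: Ns).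
have fA' : filled A' j.+1.
  split.
  - move=> w hw; rewrite (agA w hw) mem_adjoin inE; case: eqP => [e|_]; last by rewrite orbF.
    by move: hw; rewrite e sa; lia.
  - by apply: (slender_adjoin (n := n + j.+1)) => // u; rewrite inE => /eqP->.
  - move=> m hm; split=> [[u su]|hmj].
      rewrite mem_adjoin inE => /orP[uA|/eqP e]; last by move: su; rewrite e sa; lia.
      by apply: leqW; apply/(occA m hm); exists u.
    move: hmj; rewrite leq_eqVlt ltnS => /orP[/eqP->|/(occA m hm)[u su uA]].
      by exists a; rewrite // mem_adjoin inE eqxx orbT.
    by exists u; rewrite // mem_adjoin uA.
have ansA : {in queries M false x p, forall w, (w \in A) = (w \in A')}.
  move=> w hw; rewrite mem_adjoin inE; case: eqP => [e|_]; last by rewrite orbF.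
  by move: naM; rewrite -e hw.
exists A' => //; split.
  (* The list fixed by nonadaptivity over [A'] is identified by running [M] with the old [D]: [p] is
     still its computation, because [a] was not queried. *)
  have [agA' slA' _] := fA'; have [qs' _ hq'] := hna agA' slA'.
  suff -> : qs = qs' by [].
  rewrite -eqs; apply: (hq' D); rewrite -(eq_computation_queries (O := oracles A D)) //.
  by case.
apply: count_lt; first exact: (hb a sa nab).
(* If no answer on [qs] changed, [p] would also be the computation with [A'] and [D'], with the same
   outcome, although the parity has flipped. *)
move=> hDD'; have hp' : computation M (oracles A' D') x p.
  rewrite -(eq_computation_queries (O := oracles A D)) // => -[]; last exact: ansA.
  by rewrite eqs; apply: hDD'.
have := hdec fA' hj; rewrite (mem_lang_computation hM hp') -(mem_lang_computation hM hp).
by rewrite (hdec hA (ltnW hj)) /=; case: (odd j).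
Qed.

(** After [q.+1] extensions a list of at most [q] queries would contain [q.+1] accepted ones. *)
Lemma chain_absurd : slender h A0 -> (forall u : word, u \in A0 -> size u <= n) ->
  q.+1 < 2 ^ k -> False.
Proof.
move=> slA0 smA0 hqk.
suff H j : j < 2 ^ k -> exists A (qs : seq word), [/\ filled A j, size qs <= q,
    forall D p, computation M (oracles A D) x p -> queries M true x p = qs &
    j <= count (mem (sys_lang A (N :: Ns))) qs].
  have [A [qs [_ hqs _ hc]]] := H _ hqk.
  by have := leq_trans hc (leq_trans (count_size _ _) hqs); rewrite ltnn.
elim: j => [_|j IH hj].
  have [qs hqs hq] := hna (fun w _ => erefl) slA0.
  exists A0, qs; split=> //; split=> // m hm; split=> [[u su /smA0]|]; first by rewrite su; lia.
  by case: m hm.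
have [A [qs [hA hqs hq hc]]] := IH (ltnW hj).
have [A' hA' [hq' hlt]] := chain_step hA hj hqs hq.
by exists A', qs; split=> //; apply: leq_trans hlt.
Qed.
End Chain.

(** * The machine guessing a word of given length *)

Lemma polytime_of_exp (I : finType) (M : otm I) d : polytime_exp M d -> polytime M.
Proof.
move=> hd; exists (('X + 2%:P) ^+ d)%R => O x p /hd.
by rewrite horner_exp hornerD hornerX hornerC natrXE natrDE addn2.
Qed.

(** With one oracle and no work tape there are two tapes: [None] is the input tape, the other index
    the query tape. *)
Definition select A (a b : A) (j : option (unit + 'I_0)) : A :=
  if j is None then a else b.

Local Notation two_tapes a b := [ffun j => select a b j].

Lemma two_tapes_ext A (f g : {ffun option (unit + 'I_0) -> A}) :
  f None = g None -> f (Some (inl tt)) = g (Some (inl tt)) -> f = g.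
Proof. by move=> h1 h2; apply/ffunP => -[[[]|[]]|]. Qed.

Definition sym (b : bool) : symbol 0 := Some (inl b).

(** The word has been written from left to right and the head stands on the blank cell after it. *)
Definition query_tape (w : word) : tape 0 := (map sym (rev w), None, [::]).

Lemma tape_word_query w : tape_word (query_tape w) = w.
Proof.
rewrite /tape_word /query_tape map_rev revK pmap_cat /= cats0.
by elim: w => //= b w ->.
Qed.

Lemma write_query_tape w b :
  write_move (sym b) (Some true) (query_tape w) = query_tape (rcons w b).
Proof. by rewrite /query_tape rev_rcons. Qed.

Definition guess_action (s : symbol 0) (b : bool) :=
  (ord0 : 'I_4, two_tapes (s, Some true) (sym b, Some true)).

(** State 0 scans the input and guesses one bit per symbol, state 1 queries the guessed word, states
    2 and 3 accept and reject. *)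
Definition guesser : otm unit := {|
  otm_nstates := 3; otm_nsyms := 0; otm_nwork := 0;
  otm_accept := [set inord 2]%SET;
  otm_query := [ffun q => if q == inord 1 then Some tt else None];
  otm_answer := [ffun qb => inord (if qb.2 then 2 else 3)];
  otm_delta := [ffun qs : 'I_4 * {ffun tape_index unit 0 -> symbol 0} =>
    if qs.1 != ord0 then finset.set0
    else if qs.2 None is None
      then [set (inord 1, two_tapes (None, None) (None, None))]%SET
      else [set guess_action (qs.2 None) b | b : bool]%SET]
|}.

Lemma guesser_polytime : polytime guesser.
Proof.
apply: (@polytime_of_exp _ _ 2) => O x p.
(* A potential that drops at every step from any configuration: the cells still to be scanned, plus
   one step to the query state and one for the query. *)
pose mu (c : config guesser) := if c.1 == ord0
  then 2 + isSome (scanned (c.2 None)) + size (c.2 None).2 else nat_of_bool (c.1 == inord 1).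
have ne1 : (inord 1 == ord0 :> 'I_4) = false by rewrite -val_eqE /= inordK.
have ne2 b : (inord (if b then 2 else 3) == ord0 :> 'I_4) = false by rewrite -val_eqE /= inordK //; case: b.
have ne3 b : (inord (if b then 2 else 3) == inord 1 :> 'I_4) = false by rewrite -val_eqE /= !inordK //; case: b.
have dec (c c' : config guesser) : step guesser O c c' -> mu c' < mu c.
  rewrite /step /= ffunE; case: ifP => [/eqP e /eqP->|_ /existsP[a /andP[]]].
    by rewrite /mu /answered /= ffunE /= ne2 ne3 e ne1 eqxx.
  rewrite /actions /= ffunE /=; case: eqVneq => [e|_]; last by rewrite finset.inE.
  rewrite ffunE /scanned; case E: (c.2 None) => [[l [s|]] r] /=; last first.
    rewrite finset.in_set1 => /eqP-> /eqP->; by rewrite /mu /act /= ne1 e eqxx E /=.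
  move=> /imsetP[b _ ->] /eqP->; rewrite /mu /act /= !ffunE E e eqxx /=.
  by case: r {E} => [|[s'|] r] //=; rewrite ?ltnS ?leqnn //; lia.
have len c : path (step guesser O) c p -> size p <= mu c.
  elim: p c => //= c' p IH c /andP[/dec h /IH h']; exact: leq_ltn_trans h' h.
move=> /len h; apply: leq_trans h _; rewrite /mu /= ffunE.
by case: x => [|b x] //=; rewrite size_map; nia.
Qed.

Section GuesserRuns.
Variable O : unit -> language.

Definition scan_tape (l : seq (symbol 0)) (z : word) : tape 0 :=
  (l, head None (map sym z), behead (map sym z)).

Definition scan_config l z w : config guesser :=
  (ord0, two_tapes (scan_tape l z) (query_tape w)).

Definition guess_config (q : nat) l u : config guesser :=
  (inord q, two_tapes (scan_tape l [::]) u).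

Lemma initial_guesser x : initial guesser x = scan_config [::] x [::].
Proof.
rewrite /initial /scan_config; congr pair.
by apply: two_tapes_ext; rewrite !ffunE //=; case: x.
Qed.

Lemma step_scan l b z w c' : step guesser O (scan_config l (b :: z) w) c' =
  [exists d, c' == scan_config (sym b :: l) z (rcons w d)].
Proof.
rewrite /step /= ffunE -val_eqE /= inordK //=.
have actE d : act (scan_config l (b :: z) w) (guess_action (sym b) d) =
    scan_config (sym b :: l) z (rcons w d).
  by congr pair; apply: two_tapes_ext; rewrite !ffunE // write_query_tape.
have actsE : actions (scan_config l (b :: z) w) = [set guess_action (sym b) d | d : bool]%SET.
  by rewrite /actions /= !ffunE /= ?ffunE.
apply/existsP/existsP => [[a]|[d /eqP->]].
  by rewrite actsE => /andP[/imsetP[d _ ->]]; rewrite actE => h; exists d.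
by exists (guess_action (sym b) d); rewrite actE eqxx actsE imset_f.
Qed.

Lemma step_scan_end l w c' : step guesser O (scan_config l [::] w) c' =
  (c' == guess_config 1 l (query_tape w)).
Proof.
rewrite /step /= ffunE -val_eqE /= inordK //=.
pose a : action guesser := (inord 1, two_tapes (None, None) (None, None)).
have actE : act (scan_config l [::] w) a = guess_config 1 l (query_tape w).
  by congr pair; apply: two_tapes_ext; rewrite !ffunE.
have actsE : actions (scan_config l [::] w) = [set a]%SET.
  by rewrite /actions /= !ffunE /= ?ffunE.
apply/existsP/idP => [[b]|/eqP->].
  by rewrite actsE finset.in_set1 => /andP[/eqP->]; rewrite actE.
by exists a; rewrite actE eqxx actsE finset.set11.
Qed.

Lemma step_guess l w c' : step guesser O (guess_config 1 l (query_tape w)) c' =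
  (c' == guess_config (if w \in O tt then 2 else 3) l (blank_tape _)).
Proof.
rewrite /step /= ffunE eqxx; congr (c' == _).
have -> : query_word (guess_config 1 l (query_tape w)) tt = w.
  by rewrite /query_word ffunE tape_word_query.
by congr pair; rewrite ?ffunE //; apply: two_tapes_ext; rewrite !ffunE.
Qed.

Lemma halted_guess q l u : (q == 2) || (q == 3) -> halted (guess_config q l u) /\
  ((guess_config q l u).1 \in otm_accept guesser) = (q == 2).
Proof.
move=> /orP[]/eqP->; rewrite /halted /actions /= !ffunE /= -!val_eqE /= !inordK //=.
  by rewrite eqxx finset.in_set1 eqxx.
by rewrite eqxx finset.in_set1 -val_eqE /= !inordK.
Qed.

Lemma step_halted c c' : halted c -> step guesser O c c' = false.
Proof.
move=> /andP[/eqP h1 /eqP h2]; rewrite /step h1; apply/existsP => -[a].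
by rewrite h2 finset.in_set0.
Qed.

Definition accepting_from c (p : seq (config guesser)) :=
  [&& path (step guesser O) c p, halted (last c p) & (last c p).1 \in otm_accept guesser].

Fixpoint guess_path l z w u : seq (config guesser) :=
  match z, u with
  | b :: z', d :: u' =>
      scan_config (sym b :: l) z' (rcons w d) :: guess_path (sym b :: l) z' (rcons w d) u'
  | _, _ => [:: guess_config 1 l (query_tape w); guess_config 2 l (blank_tape _)]
  end.

Lemma accepting_guess_path z l w u : size u = size z -> w ++ u \in O tt ->
  accepting_from (scan_config l z w) (guess_path l z w u).
Proof.
elim: z l w u => [|b z IH] l w [|d u] //=.
  rewrite cats0 => _ h; have [h1 h2] := halted_guess l (blank_tape _) (q := 2) isT.
  by rewrite /accepting_from /= step_scan_end step_guess h !eqxx h1 h2.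
move=> [hs]; rewrite -cat_rcons => h; have := IH (sym b :: l) _ u hs h.
by rewrite /accepting_from /= step_scan -andbA => ->; rewrite andbT; apply/existsP; exists d.
Qed.

(** With [accepting_guess_path] this matches the accepting paths on an input with the oracle words
    of the same length. *)
Lemma accepting_guess_inv z l w p : accepting_from (scan_config l z w) p ->
  exists u, [/\ size u = size z, w ++ u \in O tt & p = guess_path l z w u].
Proof.
elim: z l w p => [|b z IH] l w p.
  case: p => [|c1 p] /and3P[].
    rewrite /= /halted /actions /= => _ /andP[_ /eqP] /setP /(_ (inord 1, two_tapes (None, None) (None, None))).
    by rewrite !ffunE /= ?ffunE /= finset.set11 finset.in_set0.
  rewrite /= step_scan_end => /andP[/eqP->]; case: p => [|c2 p].
    by move=> _; rewrite /halted /= ffunE eqxx.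
  rewrite /= step_guess => /andP[/eqP->].
  have [] := @halted_guess (if w \in O tt then 2 else 3) l (blank_tape 0).
    by case: ifP.
  move=> hh ha; case: p => [|c3 p] /=; last by rewrite step_halted.
  by rewrite ha; case: ifP => // hw _ _ _; exists [::]; rewrite cats0.
case: p => [|c1 p] /and3P[].
  rewrite /= /halted /actions /= => _ /andP[_ /eqP] /setP /(_ (guess_action (sym b) true)).
  by rewrite !ffunE /= ?ffunE /= imset_f // finset.in_set0.
rewrite /= step_scan => /andP[/existsP[d /eqP->] h1] h2 h3.
have [|u [hs hw ->]] := IH (sym b :: l) (rcons w d) p; first by rewrite /accepting_from h1 h2.
by exists (d :: u); rewrite /= hs -cat_rcons hw.
Qed.
End GuesserRuns.

Lemma mem_guesser A z : z \in lang guesser (oracle A) <-> occupied A (size z).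
Proof.
rewrite mem_langP; split=> [[p]|[u su uA]].
  rewrite /accepting /computation initial_guesser -andbA.
  by move=> /(@accepting_guess_inv (oracle A))[u [su uA _]]; exists u.
exists (guess_path [::] z [::] u); rewrite /accepting /computation initial_guesser -andbA.
exact: (@accepting_guess_path (oracle A)).
Qed.

Lemma guesser_at_most h A x : slender h A -> at_most_accepting guesser h (oracle A) x.
Proof.
move=> hA ps hu /allP hps.
have inv p : p \in ps -> exists u, [/\ size u = size x, u \in A & p = guess_path [::] x [::] u].
  move=> /hps; rewrite /accepting /computation initial_guesser -andbA.
  by move=> /(@accepting_guess_inv (oracle A))[u [su uA ->]]; exists u.
(* The guessed word determines the path, so distinct accepting paths yield distinct words of [A]. *)
have /choice[f hf] : forall p, exists u, p \in ps -> [/\ size u = size x, u \in A & p = guess_path [::] x [::] u].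
  by move=> p; have [/inv[u hu']|] := boolP (p \in ps); [exists u|exists [::]].
rewrite -(size_map f); apply: (hA (size x)).
  rewrite map_inj_in_uniq // => p p' hp hp' e.
  by have [_ _ ->] := hf p hp; have [_ _ ->] := hf p' hp'; rewrite e.
by apply/allP => _ /mapP[p /hf[su uA _] ->]; rewrite uA su eqxx.
Qed.

(** * The binary search machine *)

Section Runs.
Variables (M : otm unit) (O : unit -> language).

Definition asking (c : config M) : bool := otm_query M c.1 == Some tt.

(** Queries are counted without the last configuration, so that they add up under concatenation. *)
Definition run (c : config M) (t q : nat) (c' : config M) := exists p,
  [/\ path (step M O) c p, last c p = c', size p = t & count asking (belast c p) = q].

Lemma run_nil c : run c 0 0 c.
Proof. by exists [::]. Qed.

Lemma run_step c c' : step M O c c' -> run c 1 (asking c) c'.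
Proof. by move=> h; exists [:: c']; rewrite /= h addn0. Qed.

Lemma run_trans c t q c' t' q' c'' :
  run c t q c' -> run c' t' q' c'' -> run c (t + t') (q + q') c''.
Proof.
move=> [p [h1 h2 h3 h4]] [p' [h1' h2' h3' h4']]; exists (p ++ p').
by rewrite cat_path last_cat size_cat belast_cat count_cat h1 h2 h1' h3 h3' h4 h4'.
Qed.

Lemma run_computation x t q c : run (initial M x) t q c -> halted c ->
  exists p, [/\ computation M O x p, last (initial M x) p = c, size p = t
    & size (queries M tt x p) = q].
Proof.
move=> [p [h1 h2 h3 h4]] hc; exists p; split=> //; first by rewrite /computation h1 h2.
rewrite size_map size_filter lastI -cats1 count_cat h2 /= -h4 /asking.
by case/andP: hc => /eqP->; rewrite /= !addn0.
Qed.

End Runs.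

Section Searcher.
Variable k : nat.

(** The number of remaining queries, the lower end of the search interval and, during a countdown,
    the number of ones still to be written. *)
Definition search_state : finType := ('I_k.+1 * 'I_(2 ^ k).+1 * option 'I_(2 ^ k).+1)%type.

Definition code (t : search_state) : 'I_#|{: search_state}|.+1 := lift ord0 (enum_rank t).

(** [code] leaves [ord0] free for the initial state; the default reads it as [k] remaining queries,
    lower end 0 and no countdown. *)
Definition decode (q : 'I_#|{: search_state}|.+1) : nat * nat * option nat :=
  let: (i, lo, o) := odflt (ord_max, ord0, None) (omap enum_val (unlift ord0 q)) in
  (val i, val lo, omap val o).

Definition mkst i lo (o : option nat) := code (inord i, inord lo, omap inord o).

Lemma decode_mkst i lo o : i <= k -> lo <= 2 ^ k -> (if o is Some c then c <= 2 ^ k else true) ->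
  decode (mkst i lo o) = (i, lo, o).
Proof.
move=> hi hlo ho; rewrite /decode /mkst /code liftK /= enum_rankK /= !inordK //.
by case: o ho => //= c hc; rewrite inordK.
Qed.

Lemma decode0 : decode ord0 = (k, 0, None).
Proof. by rewrite /decode unlift_none. Qed.

(* Each query erases the query tape; instead of rewinding, the input is copied in
   alternating directions. [i] is the number of remaining queries. *)
Definition rightward i := ~~ odd (k - i).

Definition search_action q (s s' : symbol 0 * move) := (q : 'I_#|{: search_state}|.+1, two_tapes s s').

(** A sweep writes a one for each input symbol; on the blank after the input the head turns and a
    countdown from [lo + 2 ^ i'] starts, which appends that many ones. On an input of length [n] the
    queried word thus has length [n + (lo + 2 ^ i')]. *)
Definition search_actions q (s : symbol 0) :=
  let: (i, lo, o) := decode q in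
  if i is i'.+1 then
    match o, s with
    | None, Some a => [set search_action (mkst i lo None)
        (Some a, Some (rightward i)) (sym true, Some true)]%SET
    | None, None => [set search_action (mkst i lo (Some (lo + 2 ^ i')))
        (None, Some (~~ rightward i)) (None, None)]%SET
    | Some c, _ => [set search_action (mkst i lo (Some c.-1))
        (s, None) (sym true, Some true)]%SET
    end
  else finset.set0.

Definition searcher : otm unit := {|
  otm_nstates := #|{: search_state}|; otm_nsyms := 0; otm_nwork := 0;
  otm_accept := [set q | odd (decode q).1.2]%SET;
  otm_query := [ffun q => if (decode q).2 == Some 0 then Some tt else None];
  otm_answer := [ffun qb : 'I_#|{: search_state}|.+1 * bool =>
    let: (i, lo, _) := decode qb.1 in
    mkst i.-1 (if qb.2 then lo + 2 ^ i.-1 else lo) None];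
  otm_delta := [ffun qf : 'I_#|{: search_state}|.+1 * {ffun tape_index unit 0 -> symbol 0} =>
    search_actions qf.1 (qf.2 None)]
|}.

Lemma searcher_det : deterministic searcher.
Proof.
move=> [q f]; rewrite /= ffunE /search_actions /=; case: (decode q) => [[[|i] lo] [c|]];
  rewrite ?cards0 ?cards1 //; by case: (f None) => [a|]; rewrite cards1.
Qed.

(** The mirror image, by which leftward sweeps reduce to rightward ones. *)
Definition flip (t : tape 0) : tape 0 := (t.2, t.1.2, t.1.1).

Definition orient (d : bool) t := if d then t else flip t.

Lemma write_move_orient s d t : write_move s (Some d) (orient d t) = orient d (write_move s (Some true) t).
Proof. by case: d => //; case: t => [[]]. Qed.

Lemma write_move_back s d t :
  write_move s (Some (~~ d)) (orient d t) = orient (~~ d) (write_move s (Some true) (flip t)).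
Proof. by case: d => //; case: t => [[]]. Qed.

(* The cells [z] are about to be swept; the cells [l] and [r] lie behind and ahead of them. *)
Definition sweep_tape (l : seq (symbol 0)) (z : seq (bool + 'I_0)) (r : seq (symbol 0)) : tape 0 :=
  (l, head None (map some z ++ r), behead (map some z ++ r)).

Lemma scanned_orient d t : scanned (orient d t) = scanned t.
Proof. by case: d. Qed.

Variable O : unit -> language.

Definition search_config q (t u : tape 0) : config searcher := (q, two_tapes t u).

Lemma asking_search q t u : asking (search_config q t u) = ((decode q).2 == Some 0).
Proof. by rewrite /asking /= ffunE; case: ifP. Qed.

Lemma run_action q t u q' s s' : (decode q).2 != Some 0 ->
  search_actions q (scanned t) = [set search_action q' s s']%SET ->
  run O (search_config q t u) 1 0
    (search_config q' (write_move s.1 s.2 t) (write_move s'.1 s'.2 u)).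
Proof.
move=> hq ha; rewrite -[X in run _ _ _ X _]/(nat_of_bool false) -(negbTE hq) -(asking_search q t u).
apply: run_step; rewrite /step /= ffunE (negbTE hq).
apply/existsP; exists (search_action q' s s').
rewrite /actions /= ffunE /= !ffunE /= ha finset.set11 /=; apply/eqP; congr pair.
by apply: two_tapes_ext; rewrite !ffunE.
Qed.

Lemma run_sweep i lo l z r w q : i < k -> lo <= 2 ^ k -> decode q = (i.+1, lo, None) ->
  exists2 q', decode q' = (i.+1, lo, None) &
  run O (search_config q (orient (rightward i.+1) (sweep_tape l z r)) (query_tape w))
    (size z) 0
    (search_config q' (orient (rightward i.+1) (sweep_tape (rev (map some z) ++ l) [::] r))
       (query_tape (w ++ nseq (size z) true))).
Proof.
move=> hi hlo; elim: z l w q => [|a z IH] l w q hq.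
  by exists q => //; rewrite cats0; apply: run_nil.
have [q' hq' hrun] := IH (Some a :: l) (rcons w true) (mkst i.+1 lo None) (@decode_mkst i.+1 lo None hi hlo isT).
exists q' => //; move: hrun; rewrite cat_rcons /= rev_cons cat_rcons => hrun.
apply: (run_trans (t := 1) (q := 0) _ hrun).
rewrite -write_query_tape -[sweep_tape _ z _]/(write_move (Some a) (Some true) (sweep_tape l (a :: z) r)).
rewrite -write_move_orient.
apply: (@run_action _ _ _ _ (_, _) (_, _)); first by rewrite hq.
by rewrite /search_actions hq scanned_orient.
Qed.

Lemma rightwardS i : i < k -> rightward i = ~~ rightward i.+1.
Proof. by move=> hi; rewrite /rightward -(subnSK hi). Qed.

Lemma run_turn i lo l r w q : i < k -> decode q = (i.+1, lo, None) -> head None r = None ->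
  run O (search_config q (orient (rightward i.+1) (sweep_tape l [::] r)) (query_tape w)) 1 0
    (search_config (mkst i.+1 lo (Some (lo + 2 ^ i)))
       (orient (rightward i) (None :: behead r, head None l, behead l)) (query_tape w)).
Proof.
move=> hi hq hr.
have -> : orient (rightward i) (None :: behead r, head None l, behead l) =
    write_move None (Some (~~ rightward i.+1)) (orient (rightward i.+1) (sweep_tape l [::] r)).
  by rewrite write_move_back rightwardS.
apply: (@run_action _ _ (query_tape w) _ (_, _) (None, None)); first by rewrite hq.
by rewrite /search_actions hq scanned_orient /scanned /= hr.
Qed.

Lemma run_countdown i lo c t w q : i < k -> lo <= 2 ^ k -> c <= 2 ^ k ->
  decode q = (i.+1, lo, Some c) ->
  exists2 q', decode q' = (i.+1, lo, Some 0) &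
  run O (search_config q t (query_tape w)) c 0 (search_config q' t (query_tape (w ++ nseq c true))).
Proof.
move=> hi hlo; elim: c w q => [|c IH] w q hc hq.
  by exists q => //; rewrite cats0; apply: run_nil.
have [q' hq' hrun] := IH (rcons w true) _ (ltnW hc) (@decode_mkst i.+1 lo (Some c) hi hlo (ltnW hc)).
exists q' => //; move: hrun; rewrite cat_rcons => hrun.
apply: (run_trans (t := 1) (q := 0) _ hrun).
have tE : write_move (scanned t) None t = t by case: (t) => [[]].
rewrite -write_query_tape -{2}tE.
apply: (@run_action _ _ _ _ (_, _) (_, _)); first by rewrite hq.
by rewrite /search_actions hq.
Qed.

Lemma run_query i lo t w q : decode q = (i.+1, lo, Some 0) ->
  run O (search_config q t (query_tape w)) 1 1
    (search_config (mkst i (if w \in O tt then lo + 2 ^ i else lo) None) t (query_tape [::])).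
Proof.
move=> hq; have := asking_search q t (query_tape w); rewrite hq eqxx => ha.
rewrite -[X in run _ _ _ X _]/(nat_of_bool true) -ha.
apply: run_step; rewrite /step /= ffunE hq eqxx; apply/eqP; congr pair.
  by rewrite !ffunE /= hq /query_word ffunE tape_word_query.
by apply: two_tapes_ext; rewrite !ffunE.
Qed.

Fixpoint search n i lo : nat :=
  if i is i'.+1 then
    search n i' (if nseq (n + (lo + 2 ^ i')) true \in O tt then lo + 2 ^ i' else lo)
  else lo.

(** The summands of the time are the sweep, the turn, the countdown and the query. *)
Lemma run_round i lo l z r q : i < k -> lo + 2 ^ i.+1 <= 2 ^ k -> decode q = (i.+1, lo, None) ->
  head None r = None ->
  let lo' := if nseq (size z + (lo + 2 ^ i)) true \in O tt then lo + 2 ^ i else lo in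
  run O (search_config q (orient (rightward i.+1) (sweep_tape l z r)) (query_tape [::]))
    (size z + (1 + (lo + 2 ^ i + 1))) 1
    (search_config (mkst i lo' None)
       (orient (rightward i) (sweep_tape (None :: behead r) (rev z) l)) (query_tape [::])).
Proof.
move=> hi hlo hq hr lo'.
have hlo1 : lo + 2 ^ i <= 2 ^ k by apply: leq_trans hlo; rewrite leq_add2l leq_exp2l.
have hlo0 : lo <= 2 ^ k by apply: leq_trans hlo1; apply: leq_addr.
have [q1 hq1 run1] := run_sweep l z r [::] hi hlo0 hq.
have run2 := run_turn (rev (map some z) ++ l) (nseq (size z) true) hi hq1 hr.
have [q2 hq2 run3] := run_countdown (orient (rightward i) (sweep_tape (None :: behead r) (rev z) l))
  (nseq (size z) true) hi hlo0 hlo1 (@decode_mkst i.+1 lo (Some (lo + 2 ^ i)) hi hlo0 hlo1).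
have run4 := run_query (orient (rightward i) (sweep_tape (None :: behead r) (rev z) l))
  (nseq (size z + (lo + 2 ^ i)) true) hq2.
apply: (run_trans (q := 0) (q' := 1) run1 _); apply: (run_trans (q := 0) (q' := 1) run2 _).
rewrite -map_rev; apply: (run_trans (q := 0) (q' := 1) run3 _).
by rewrite -nseqD.
Qed.

(** Each round leaves the input reversed and its two sides exchanged, so the induction ranges over
    all [z], [l] and [r] with blanks next to the input. *)
Lemma run_search i lo l z r q : i <= k -> lo + 2 ^ i <= 2 ^ k -> decode q = (i, lo, None) ->
  head None l = None -> head None r = None ->
  exists t c, [/\ t <= i * (size z + 2 ^ k + 2),
    run O (search_config q (orient (rightward i) (sweep_tape l z r)) (query_tape [::])) t i c &
    decode c.1 = (0, search (size z) i lo, None)].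
Proof.
elim: i lo l z r q => [|i IH] lo l z r q hi hlo hq hl hr.
  by exists 0; eexists; split; [|exact: run_nil|].
have hr1 := run_round l z hi hlo hq hr.
set lo' := if _ then _ else _ in hr1.
have hlo' : lo' + 2 ^ i <= 2 ^ k.
  by apply: leq_trans hlo; rewrite expnS mul2n -addnn addnA leq_add2r /lo'; case: ifP => // _; apply: leq_addr.
have lo'k : lo' <= 2 ^ k by apply: leq_trans hlo'; apply: leq_addr.
have [t [c [ht hrun hc]]] := IH lo' (None :: behead r) (rev z) l _ (ltnW hi) hlo'
  (@decode_mkst i lo' None (ltnW hi) lo'k isT) erefl hl.
exists (size z + (1 + (lo + 2 ^ i + 1)) + t), c; split.
- move: ht hlo; rewrite size_rev expnS [i.+1 * _]mulSn; generalize (i * (size z + 2 ^ k + 2)) (2 ^ k) (2 ^ i) (size z) => d a b e.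
  by lia.
- exact: run_trans hr1 hrun.
- by rewrite hc /= size_rev.
Qed.

Lemma searcher_run (x : word) : exists p, [/\ computation searcher O x p,
  (last (initial searcher x) p).1 \in otm_accept searcher = odd (search (size x) k 0),
  size p <= k * (size x + 2 ^ k + 2) & size (queries searcher tt x p) = k].
Proof.
have [t [c [ht hrun hc]]] := @run_search k 0 [::] (map inl x) [::] ord0 (leqnn k) (leqnn _) decode0 erefl erefl.
move: ht hrun hc; rewrite size_map => ht hrun hc.
have ini : initial searcher x = search_config ord0 (orient (rightward k) (sweep_tape [::] (map inl x) [::])) (query_tape [::]).
  rewrite /initial /search_config /rightward subnn; congr pair; apply: two_tapes_ext; rewrite !ffunE //=.
  by rewrite /sweep_tape cats0 -map_comp; case: x {ht hrun hc}.
have hh : halted c.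
  by rewrite /halted /actions /= !ffunE hc /= /search_actions hc !eqxx.
move: hrun; rewrite -ini => /run_computation /(_ hh)[p [h1 h2 h3 h4]].
by exists p; rewrite h2 h3 h4; split=> //; rewrite /= finset.in_set hc.
Qed.

End Searcher.

(** By determinism every path is a prefix of the complete computation, whose length is bounded for
    every oracle. *)
Lemma searcher_polytime k : polytime (searcher k).
Proof.
exists ('X * k%:R%:P + (k * (2 ^ k + 2))%:R%:P)%R => O x p hp.
have [p' [h1 _ hs _]] := searcher_run k O x.
have [s e] := computation_det (@searcher_det k) hp h1.
apply: (@leq_trans (size p')); first by rewrite e size_cat leq_addr.
apply: leq_trans hs _; rewrite hornerD hornerM hornerX !hornerC !natn natrDE natrME; lia.
Qed.

Lemma searcher_queries k O x p : computation (searcher k) O x p ->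
  size (queries (searcher k) tt x p) <= k.
Proof.
move=> hp; have [p' [h1 _ _ hq]] := searcher_run k O x.
by rewrite (computation_unique (@searcher_det k) hp h1) hq.
Qed.

Lemma mem_searcher k O x : (x \in lang (searcher k) O) = odd (search O (size x) k 0).
Proof.
have [p [h1 h2 _ _]] := searcher_run k O x.
by rewrite (mem_lang_computation (@searcher_det k) h1) h2.
Qed.

(** Each query compares [j] with the midpoint of the interval, which is then halved around [j]. *)
Lemma search_interval O n j i lo : (forall m, 0 < m -> (nseq (n + m) true \in O tt) = (m <= j)) ->
  lo <= j < lo + 2 ^ i -> search O n i lo = j.
Proof.
move=> hO; elim: i lo => [|i IH] lo /=; first by rewrite expn0; lia.
rewrite expnS hO; last by rewrite addn_gt0 expn_gt0 orbT.
by move=> h; apply: IH; case: ifP => hc; move: h hc; generalize (2 ^ i) => u; lia.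
Qed.

(** * Diagonalization *)

Definition otm_data (I : finType) (d : nat * nat * nat) : finType :=
  let: (n, g, w) := d in
  ({set 'I_n.+1} * {ffun 'I_n.+1 -> option I} * {ffun 'I_n.+1 * bool -> 'I_n.+1} *
   {ffun 'I_n.+1 * {ffun tape_index I w -> symbol g} ->
      {set 'I_n.+1 * {ffun tape_index I w -> symbol g * move}}})%type.

(** A machine amounts to three sizes and tables over finite types, an element of a countable
    dependent sum. *)
Lemma otm_countable (I : finType) : exists f : otm I -> nat, injective f.
Proof.
pose to (M : otm I) : {d & otm_data I d} := existT (fun d => otm_data I d)
  (otm_nstates M, otm_nsyms M, otm_nwork M)
  (otm_accept M, otm_query M, otm_answer M, otm_delta M).
pose from (u : {d & otm_data I d}) : otm I :=
  let: existT (n, g, w) (a, q, r, t) := u in @OTM I n g w a q r t.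
have toK : cancel to from by case.
by exists (pickle \o to); apply: inj_comp (pcan_inj pickleK) (can_inj toK).
Qed.

(** A Baire category argument: each stage holds a language satisfying [P] and a length up to which
    it is frozen, and secures one requirement. The limit itself is only approximated by languages
    satisfying [P]. *)
Lemma baire_diagonal (P : language -> Prop) (R : nat -> language -> Prop) :
  (exists A, P A) ->
  (forall s A m, P A -> exists A' m', [/\ P A', agree m A A', m < m' &
     forall A'', agree m' A' A'' -> R s A'']) ->
  exists A, (forall s, R s A) /\ (forall m, exists2 A', P A' & agree m A' A).
Proof.
move=> [A0 hA0] ext.
have /choice[f hf] : forall sAm : nat * (language * nat), exists Am : language * nat,
    P sAm.2.1 -> [/\ P Am.1, agree sAm.2.2 sAm.2.1 Am.1, sAm.2.2 < Am.2 &
      forall A, agree Am.2 Am.1 A -> R sAm.1 A].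
  move=> [s [A m]] /=; have [hA|hA] := pselect (P A); last by exists (A, m).
  by have [A' [m' h]] := ext s A m hA; exists (A', m').
pose st := fix st s := if s is s'.+1 then f (s', st s') else (A0, 0).
have Pst s : P (st s).1 by elim: s => //= s /(hf (s, st s))[].
have step s : [/\ agree (st s).2 (st s).1 (st s.+1).1, (st s).2 < (st s.+1).2 &
    forall A, agree (st s.+1).2 (st s.+1).1 A -> R s A].
  by have [] := hf (s, st s) (Pst s).
have mono s t : s <= t -> (st s).2 <= (st t).2 /\ agree (st s).2 (st s).1 (st t).1.
  move=> /subnKC <-; elim: (t - s) => [|d [IH1 IH2]]; first by rewrite addn0.
  rewrite addnS; have [h1 h2 _] := step (s + d); split; first exact: leq_trans IH1 (ltnW h2).
  exact: agree_trans IH2 (agreeW IH1 h1).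
have large s : s <= (st s).2.
  by elim: s => // s IH; have [_ h _] := step s; apply: leq_ltn_trans IH h.
(* Stage [s] freezes all lengths up to [s], so stage [size w] already decides [w]. *)
pose A : language := [set w | w \in (st (size w)).1].
have agA s : agree (st s).2 (st s).1 A.
  move=> w hw; have -> : (w \in A) = (w \in (st (size w)).1).
    by apply/idP/idP => [/set_mem|h] //; apply/mem_set.
  have [_ h1] := mono _ _ (leq_maxl s (size w)).
  have [_ h2] := mono _ _ (leq_maxr s (size w)).
  by rewrite h1 // h2 // large.
exists A; split=> [s|m]; first by have [_ _ h] := step s; apply: h.
by exists (st m).1 => //; apply: agreeW (agA m); apply: large.
Qed.

(** * Defeating a single competitor *)

Section Requirement.
Variables (k h : nat) (M : otm bool) (N : otm unit) (Ns : seq (otm unit)).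
Hypotheses (hM : deterministic M) (pM : polytime M) (pN : polytime N) (pNs : sys_polytime Ns).

Definition hard_language A := sys_lang A [:: searcher k; guesser].

Definition simulated A := [/\ sys_unambiguous A Ns,
  forall x, nonadaptive M A (2 ^ k - 2) x &
  hard_language A = lang M (oracles A (sys_lang A (N :: Ns)))].

Lemma computation_local d n A A' D x p : polytime_exp M d -> size x <= n ->
  agree (n.+2 ^ d).+1 A A' -> computation M (oracles A D) x p = computation M (oracles A' D) x p.
Proof.
by move=> hd hx hA; rewrite /computation (path_local hd (O' := oracles A' D) _ _ hx) // => -[].
Qed.

(** Whichever of the three conditions fails, a finite part of [A] shows it; the failure therefore
    persists under later extensions. *)
Lemma not_simulated_open A : ~ simulated A ->
  exists m, forall A', agree m A A' -> ~ simulated A'.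
Proof.
have [dM hdM] := polytimeP pM.
move=> hA; have [un|un] := pselect (sys_unambiguous A Ns); last first.
  by have [m hm] := sys_unambiguous_local pNs un; exists m => A' /hm h' [].
(* On a fixed [x] only words of bounded length are queried to [A], whatever [D] is. *)
have [na|/existsNP[x hx]] := pselect (forall x, nonadaptive M A (2 ^ k - 2) x); last first.
  exists ((size x).+2 ^ dM).+1 => A' agA [_ /(_ x)[qs hqs hq] _]; apply: hx.
  exists qs => // D p; rewrite (computation_local D p hdM (leqnn _) agA); exact: hq.
have [x hx] : exists x, (x \in hard_language A) <> (x \in lang M (oracles A (sys_lang A (N :: Ns)))).
  by apply: contrapT => /forallNP e; apply: hA; split=> //; apply: language_ext => x; apply: contrapT; apply: e.
have [m1 hm1] := @sys_lang_local [:: searcher k; guesser] (conj (searcher_polytime k) (conj guesser_polytime I)) (size x).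
have [m2 hm2] := @sys_lang_local (N :: Ns) (conj pN pNs) ((size x).+2 ^ dM).+1.
pose m3 := ((size x).+2 ^ dM).+1.
exists (m1 + m2 + m3) => A' agA [_ _ e]; apply: hx.
rewrite [X in X = _](hm1 A A') //; last by apply: agreeW agA; lia.
rewrite -[sys_lang A' _]/(hard_language A') e.
apply: agreeS (leqnn (size x)); apply: (lang_local hdM) => -[] /=.
  by apply: hm2; apply: agreeW agA; lia.
by apply: agreeW agA; lia.
Qed.

Hypotheses (hk : 0 < k) (hh : 0 < h).
(** The second alternative serves [h = 1]: a language in P is given by one deterministic machine, a
    system of length 1 rather than [h - 1], which is unambiguous over every oracle. *)
Hypothesis hNs : size Ns = h - 1 \/ forall A, sys_unambiguous A Ns.

Lemma exists_not_simulated A m : slender h A ->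
  exists A', [/\ slender h A', agree m A A' & ~ simulated A'].
Proof.
move=> slA; apply: contrapT => hno.
have sim A' : slender h A' -> agree m A A' -> simulated A'.
  by move=> h1 h2; apply: contrapT => h3; apply: hno; exists A'.
have [dM hdM] := polytimeP pM; have [dN hdN] := polytimeP pN.
have [c hc] := sys_stable pNs.
pose q := 2 ^ k - 2; pose e := dM.+2 * (dN.+2 * c.+1).
(* Both summands in the count of forbidden words are at most [n.+2 ^ (dM.+2 + q + e)]; the last
   successor absorbs their sum. *)
have [n hmn hn] := exp_lt_exp2 (dM.+2 + q + e).+1 m.
(* Truncation frees all lengths above [n] and, as [m <= n], keeps the agreement with [A] up to
   [m]. *)
pose A0 : language := [set w | w \in A /\ size w <= n].
have memA0 w : (w \in A0) = (w \in A) && (size w <= n).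
  by apply/idP/andP => [/set_mem|h'] //; apply/mem_set.
have slA0 : slender h A0.
  move=> l us hu hus; apply: (slA l) => //; apply: sub_all hus => u.
  by rewrite memA0 -andbA => /and3P[-> _ ->].
have agA0 A' : agree n A0 A' -> agree m A A'.
  by move=> ag w hw; have hwn := leq_trans hw hmn; rewrite -ag // memA0 hwn andbT.
have hk2 : 2 <= 2 ^ k by rewrite -{1}(expn1 2) leq_exp2l.
apply: (@chain_absurd h k q c dM dN M N Ns hh hM hdM hdN A0 n (nseq n true) hc) => //.
(* Here [T] has at most [size Ns + 1 = h] words, all of one unoccupied length, so adjoining it keeps
   the language slender and hence simulated. *)
- move=> A' l T ag sl hl hA' hT hTl; case: hNs => [sNs|]; last exact.
  have [||//] := sim (adjoin A' T); last apply: agA0.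
    by apply: (slender_adjoin (n := l)) => //; move: hT; rewrite sNs; lia.
  move=> w hw; rewrite ag // mem_adjoin; case: (boolP (w \in T)) => [/hTl e'|]; last by rewrite orbF.
  by move: hw; rewrite e'; lia.
- by move=> A' ag sl; have [|_ + _] := sim A' sl; [apply: agA0|apply].
- rewrite size_nseq; apply: leq_ltn_trans hn.
  have pos u : 0 < n.+2 ^ u by rewrite expn_gt0.
  have hK : n.+2 ^ dM + 3 <= n.+2 ^ dM.+2.
    by apply: leq_trans (exp_slack _ _); rewrite -[X in _ <= X]addn2 -addnA leq_add2l addn2 !ltnS.
  rewrite expnS; apply: (@leq_trans (n.+2 ^ (dM.+2 + q + e) + n.+2 ^ (dM.+2 + q + e))); last by nia.
  apply: leq_add.
    by apply: (@leq_trans (n.+2 ^ dM.+2)); [lia|rewrite leq_exp2l //; lia].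
  apply: (@leq_trans (n.+2 ^ q * n.+2 ^ e)); last by rewrite -expnD leq_exp2l //; lia.
  apply: leq_mul; first by apply: ltnW; apply: ltn_expl.
  rewrite /e [X in _ <= X]expnM; apply: leq_exp_base.
  by apply: leq_trans hK; rewrite addn3.
- move=> A' j [ag sl occ] hj; have [|_ _ <-] := sim A' sl; first exact: agA0.
  rewrite /hard_language /= mem_searcher size_nseq; congr odd.
  apply: search_interval => // i hi; apply/idP/idP.
    by move=> /mem_guesser; rewrite size_nseq => /(occ i hi).
  by move=> /(occ i hi) h'; apply/mem_guesser; rewrite size_nseq.
- by move=> u; rewrite memA0 => /andP[].
- by rewrite /q; lia.
Qed.

End Requirement.

Theorem theorem4p13 (k h : nat) (hk : 1 <= k) (hh : 1 <= h) :
  exists A : language,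
    ~ (R_T k (class_UPle h A)
         `<=` R_tt (2 ^ k - 2) A (class_NP (class_USigma (h - 1) A))).
Proof.
have [f1 f1I] := otm_countable bool; have [f2 f2I] := otm_countable unit.
pose code (M : otm bool) (N : otm unit) Ns := pickle (f1 M, f2 N, map f2 Ns).
pose admissible (M : otm bool) (N : otm unit) Ns := [/\ deterministic M, polytime M, polytime N,
  sys_polytime Ns & size Ns = h - 1 \/ forall A, sys_unambiguous A Ns].
(* As [code] is injective, each [s] stands for at most one competitor. *)
pose R s A := forall M N Ns, code M N Ns = s -> admissible M N Ns -> ~ simulated k M N Ns A.
have [||A [hR hA]] := @baire_diagonal (slender h) R.
- exists set0 => n us _; case: us => //= u us; rewrite -andbA => /and3P[/set_mem].
  by [].
- move=> s A m slA.
  have [[M [N [Ns [hs adm]]]]|none] := pselect (exists M N Ns, code M N Ns = s /\ admissible M N Ns); last first.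
    exists A, m.+1; split=> // A' _ M N Ns hs adm; case: none; by exists M, N, Ns.
  have [hM pM pN pNs hNs] := adm.
  have [A' [slA' agA hA']] := exists_not_simulated hM pM pN pNs hk hh hNs m slA.
  have [m' hm'] := not_simulated_open pM pN pNs hA'.
  exists A', (m + m').+1; split=> //; first by rewrite ltnS leq_addr.
  move=> A'' agA' M1 N1 Ns1; rewrite -hs => /(pcan_inj pickleK)[/f1I-> /f2I-> /(inj_map f2I)->] _.
  by apply: hm'; apply: agreeW agA'; rewrite ltnW // ltnS leq_addl.
have slA : slender h A.
  by apply: slender_agree => m; have [A' h1 h2] := hA m; exists A' => //; apply: agreeS.
exists A => incl.
have /incl [D [M [[D0 [N [hD0 pN eD]]] hM pM na eL]]] :
    R_T k (class_UPle h A) (hard_language k A).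
  exists (lang guesser (oracle A)), (searcher k); split=> //.
  - by exists guesser; split=> //; [exact: guesser_polytime|move=> x; apply: guesser_at_most].
  - exact: searcher_det.
  - exact: searcher_polytime.
  - by move=> x p; apply: searcher_queries.
have [Ns [pNs unA hNs eD0]] : exists Ns, [/\ sys_polytime Ns, sys_unambiguous A Ns,
    size Ns = h - 1 \/ (forall A, sys_unambiguous A Ns) & D0 = sys_lang A Ns].
  move: hD0; rewrite /class_USigma; case: (h - 1) => [[M0 [hM0 pM0 ->]]|j [Ns [h1 h2 h3 ->]]].
    by exists [:: M0]; split=> //=; [split=> // y|right=> A']; try split=> //; try move=> y; apply: deterministic_unambiguous.
  by exists Ns; split=> //; left.
apply: (hR (code M N Ns) M N Ns erefl) => //.
by split=> //; rewrite eL eD eD0.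
Qed.
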